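(* Let $F_q$ be the finite field with $q$ elements, $V=F_q^n$, and $1<k<n-1$. Let $U$ be a projective code $[n,k+1]_q$ with generator matrix $M$ whose rows $v_1,\dots,v_{k+1}$ form a basis of $U$ and whose columns are $l_1,\dots,l_n\in F_q^{k+1}$. Let $W$ be the set of all non-zero vectors $w\in F_q^{k+1}$ not proportional to any column of $M$, for $w=(w_1,\dots,w_{k+1})\in W$ let $C(w)=\{\sum_{i=1}^{k+1}a_iv_i : a_i\in F_q,\ \sum_{i=1}^{k+1}a_iw_i=0\}$, and let $Y\subseteq W$ be the set of all $w\in W$ such that $w\neq\alpha l_i+\beta l_j$ for all $\alpha,\beta\in F_q\setminus\{0\}$ and all columns $l_i,l_j$ of $M$. Let $\langle U]^{\Pi}_k$ be the set of all projective codes $[n,k]_q$ contained in $U$. Then $\langle U]^{\Pi}_k$ is a maximal clique of the graph $\Pi[n,k]_q$ if and only if either $\langle U]^{\Pi}_k$ is not contained in any line of $\mathcal G_k(V)$, or $S:=\bigcap_{y\in Y}C(y)$ is a $(k-1)$-dimensional subspace of $V$ such that $\langle U]^{\Pi}_k=[S\rangle^{\Pi}_k$.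
   Context: A linear code $[n,k]_q$ is a $k$-dimensional subspace of $V=F_q^n$; a generator matrix is a matrix whose rows form a basis of the code. A linear code is projective if its generator matrices contain no zero columns and no two proportional columns. $\Pi[n,k]_q$ is the graph whose vertices are the projective codes $[n,k]_q$, two distinct vertices being adjacent if their intersection is $(k-1)$-dimensional. A clique is a set of pairwise adjacent vertices; it is maximal if not properly contained in another clique. $\mathcal G_k(V)$ denotes the set of $k$-dimensional subspaces of $V$; a line of $\mathcal G_k(V)$ is a set $[S,U']_k$ of all $k$-dimensional subspaces $K$ with $S\subset K\subset U'$, where $\dim S=k-1$, $\dim U'=k+1$, $S\subset U'$. For a $(k-1)$-dimensional subspace $S$, $[S\rangle^{\Pi}_k$ is the set of all projective codes $[n,k]_q$ containing $S$.
   Formalization: Cliques are required to be non-empty; if the empty set counted as a clique, the claim would fail when no projective [n,k]_q code exists (e.g. q=2, k=2, n=5), since the empty set would be a maximal clique while both alternatives are false. *)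

(* Defs.v *)
From mathcomp Require Import all_boot all_order all_algebra.

Set Implicit Arguments.
Unset Strict Implicit.
Unset Printing Implicit Defensive.

Import GRing.Theory.
Local Open Scope ring_scope.

Section Codes.

Variables (F : finFieldType) (n : nat).
Local Notation V := 'rV[F]_n.

Definition generator_matrix (m : nat) (M : 'M[F]_(m, n)) (C : {vspace V}) : bool :=
  basis_of C [seq row i M | i : 'I_m].

(* The nonzero factor makes this an equivalence relation; on nonzero vectors,
   the only ones to which it is applied effectively, the restriction is vacuous. *)
Definition proportional (m : nat) (u v : 'cV[F]_m) : bool :=
  [exists a : F, (a != 0) && (v == a *: u)].

Definition projective_columns (m : nat) (M : 'M[F]_(m, n)) : bool :=
  [forall j, col j M != 0] &&
  [forall i, forall j, (i != j) ==> ~~ proportional (col i M) (col j M)].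

Definition projective_code (k : nat) : {pred {vspace V}} :=
  [pred C : {vspace V} | (\dim C == k) &&
    [forall M : 'M[F]_(k, n), generator_matrix M C ==> projective_columns M]].

Definition adjacent (k : nat) (K L : {vspace V}) : bool :=
  [&& K \in projective_code k, L \in projective_code k,
      K != L & \dim (K :&: L)%VS == k.-1].

(* Cliques are nonempty. If the empty set were allowed, it would be a maximal
   clique when no projective [n, k] code exists, although projective
   [n, k + 1] codes may exist then (e.g. over F_2 with n = 5, k = 2). *)
Definition clique (k : nat) (A : {pred {vspace V}}) : Prop :=
  [/\ exists K, K \in A,
      {subset A <= projective_code k}
    & {in A &, forall K L, K != L -> adjacent k K L}].

Definition maximal_clique (k : nat) (A : {pred {vspace V}}) : Prop :=
  clique k A /\
  forall B : {pred {vspace V}}, clique k B -> {subset A <= B} -> B =i A.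

Definition segment (k : nat) (S U : {vspace V}) : {pred {vspace V}} :=
  [pred K : {vspace V} | [&& \dim K == k, (S <= K)%VS & (K <= U)%VS]].

Definition is_line (k : nat) (L : {pred {vspace V}}) : Prop :=
  exists S U : {vspace V},
    [/\ \dim S = k.-1, \dim U = k.+1, (S <= U)%VS & L =i segment k S U].

Definition projective_star (k : nat) (S : {vspace V}) : {pred {vspace V}} :=
  [pred K : {vspace V} | (K \in projective_code k) && (S <= K)%VS].

Definition projective_top (k : nat) (U : {vspace V}) : {pred {vspace V}} :=
  [pred K : {vspace V} | (K \in projective_code k) && (K <= U)%VS].

Definition Wset (m : nat) (M : 'M[F]_(m, n)) : {set 'cV[F]_m} :=
  [set w | (w != 0) && [forall j, ~~ proportional (col j M) w]].

Definition Yset (m : nat) (M : 'M[F]_(m, n)) : {set 'cV[F]_m} :=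
  [set w in Wset M | [forall i, forall j, forall a : F, forall b : F,
     (a != 0) ==> (b != 0) ==> (w != a *: col i M + b *: col j M)]].

(* The image under a |-> a *m M of the kernel of a |-> a *m w; see subcodeP. *)
Definition subcode (m : nat) (M : 'M[F]_(m, n)) (w : 'cV[F]_m) : {vspace V} :=
  (linfun (mulmxr M) @: lker (linfun (mulmxr w : 'rV[F]_m -> 'M[F]_1)))%VS.

Lemma subcodeP (m : nat) (M : 'M[F]_(m, n)) (w : 'cV[F]_m) (v : V) :
  reflect (exists2 a : 'I_m -> F, \sum_i a i * w i 0 = 0
                                & v = \sum_i a i *: row i M)
          (v \in subcode M w).
Proof.
apply: (iffP memv_imgP) => [[a aw ->]|[a aw ->]].
  exists (a 0).
    move: aw; rewrite memv_ker lfunE /= => /eqP/matrixP/(_ 0 0).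
    by rewrite !mxE.
  by rewrite lfunE /= mulmx_sum_row.
exists (\row_i a i).
  rewrite memv_ker lfunE /=; apply/eqP/matrixP => i j.
  rewrite !ord1 !mxE -[RHS]aw; apply: eq_bigr => l _; by rewrite mxE.
rewrite lfunE /= mulmx_sum_row; apply: eq_bigr => l _; by rewrite mxE.
Qed.

End Codes.

(* Main.v *)
(** In coordinates given by a generator matrix [M] of [U], the hyperplanes of
    [U] are the codes [subcode M w], and such a code is projective exactly when
    [w] lies in [Yset M]; hence the intersection over [Yset M] is the
    intersection of all members of the top of [U]. A projective code outside
    the top but adjacent to all its members [L] meets each [L] in its
    intersection with [U]; this intersection has dimension [k - 1] and puts the
    top inside a line. So a top lying in no line is maximal, and a top with at
    least two members lying in a line is maximal iff it is the whole star of
    the intersection of its members. A top with a single member [K] is never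
    maximal: swapping two coordinates of [K] yields a projective code sharing
    with [K] a hyperplane of [K], and if every swap fixed [K], then [K] would
    contain all differences of standard vectors, so [k >= n - 1]. *)

Require Import Defs.
From mathcomp Require Import all_boot all_order all_algebra.
From mathcomp Require Import perm zify.

Set Implicit Arguments.
Unset Strict Implicit.
Unset Printing Implicit Defensive.

Import GRing.Theory.
Local Open Scope ring_scope.

Section ProjectiveCodes.

Variables (F : finFieldType) (n : nat).
Local Notation V := 'rV[F]_n.
Implicit Types (C K L S U : {vspace V}) (k m : nat).

(* No nonzero linear form supported on two coordinates vanishes on [C]; this is
   projectivity without a choice of generator matrix. *)
Definition separates_coordinates C : Prop :=
  forall i j (a b : F), i != j ->
    (forall c : V, c \in C -> a * c 0 i + b * c 0 j = 0) -> a = 0 /\ b = 0.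

(** * Codes as images of generator matrices *)

Lemma limg_generator_matrix m (M : 'M[F]_(m, n)) C :
  generator_matrix M C -> limg (linfun (mulmxr M : 'rV[F]_m -> V)) = C.
Proof.
rewrite /generator_matrix => /andP[/eqP <- _]; apply/eqP; rewrite eqEsubv.
apply/andP; split.
  apply/subvP => _ /memv_imgP[x _ ->]; rewrite lfunE /= mulmx_sum_row.
  apply: memv_suml => i _; rewrite memvZ // memv_span //.
  by apply/mapP; exists i; rewrite ?mem_enum.
apply/span_subvP => _ /mapP[i _ ->].
by apply/memv_imgP; exists (delta_mx 0 i); rewrite ?memvf // lfunE /= -rowE.
Qed.

Lemma generator_matrix_memP m (M : 'M[F]_(m, n)) C (v : V) :
  generator_matrix M C ->
  reflect (exists x : 'rV[F]_m, v = x *m M) (v \in C).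
Proof.
move=> gM; rewrite -(limg_generator_matrix gM).
apply: (iffP memv_imgP) => [[x _ ->] | [x ->]]; exists x; rewrite ?memvf //.
  by rewrite lfunE.
by rewrite lfunE.
Qed.

Lemma dim_generator_matrix m (M : 'M[F]_(m, n)) C :
  generator_matrix M C -> \dim C = m.
Proof.
rewrite /generator_matrix => /andP[/eqP <-]; rewrite /free => /eqP ->.
by rewrite size_image card_ord.
Qed.

Lemma lker_generator_matrix m (M : 'M[F]_(m, n)) C :
  generator_matrix M C -> lker (linfun (mulmxr M : 'rV[F]_m -> V)) = 0%VS.
Proof.
move=> gM; apply/eqP; rewrite -dimv_eq0.
have := limg_ker_dim (linfun (mulmxr M : 'rV[F]_m -> V)) fullv.
rewrite (limg_generator_matrix gM) (dim_generator_matrix gM) capfv dimvf /dim /=.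
lia.
Qed.

Lemma generator_matrix_exists C : exists M : 'M[F]_(\dim C, n), generator_matrix M C.
Proof.
exists (\matrix_i (vbasis C)`_i); rewrite /generator_matrix.
suff -> : [seq row i (\matrix_i0 (vbasis C)`_i0) | i : 'I_(\dim C)] = vbasis C.
  exact: vbasisP.
apply: (@eq_from_nth _ 0) => [|i]; rewrite size_image card_ord.
  by rewrite size_tuple.
move=> lt_i; rewrite (nth_map (Ordinal lt_i)) ?size_enum_ord //.
by rewrite rowK nth_enum_ord.
Qed.

Lemma ord_neq_exists (j : 'I_n) : (1 < n)%N -> exists i : 'I_n, i != j.
Proof.
move=> n_gt1; have [/= j0 | j_nz] := eqVneq (j : nat) 0%N.
  by exists (Ordinal n_gt1); rewrite -val_eqE /= j0.
by exists (Ordinal (ltnW n_gt1)); rewrite -val_eqE /= eq_sym.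
Qed.

(** Moves a form on two coordinates of the codeword [x *m M] to the message [x], where a combination
    of two columns represents it. *)
Lemma col_combE m (M : 'M[F]_(m, n)) (x : 'rV[F]_m) i j a b :
  a * (x *m M) 0 i + b * (x *m M) 0 j
  = (x *m (a *: col i M + b *: col j M)) 0 0.
Proof. by rewrite mulmxDr -!scalemxAr !colE !mulmxA -!colE !mxE. Qed.

(** By [col_combE], tested on the unit messages, a two-coordinate form kills [C] exactly when the
    same combination of columns is zero. *)
Lemma projective_columnsP m (M : 'M[F]_(m, n)) C :
    (1 < n)%N -> generator_matrix M C ->
  reflect (separates_coordinates C) (projective_columns M).
Proof.
move=> n_gt1 gM.
have comb0P i j a b : (forall c : V, c \in C -> a * c 0 i + b * c 0 j = 0) <->
    a *: col i M + b *: col j M = 0.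
  split=> [C0 | E c /(generator_matrix_memP _ gM)[x ->]]; last first.
    by rewrite col_combE E mulmx0 mxE.
  apply/colP => l; have Ml : delta_mx 0 l *m M \in C.
    by apply/(generator_matrix_memP _ gM); exists (delta_mx 0 l).
  by have := C0 _ Ml; rewrite col_combE -rowE !mxE.
apply: (iffP andP) => [[/forallP nz /forallP np] i j a b ij /comb0P E | sep].
  have [a0 | a_nz] := eqVneq a 0.
    split=> //; move: E; rewrite a0 scale0r add0r => /eqP.
    by rewrite scaler_eq0 (negbTE (nz j)) orbF => /eqP.
  have [b0 | b_nz] := eqVneq b 0.
    move: E; rewrite b0 scale0r addr0 => /eqP.
    by rewrite scaler_eq0 (negbTE (nz i)) orbF => /eqP.
  have /forallP/(_ j) := np i; rewrite ij /= => /existsP[].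
  exists (- (b^-1 * a)); rewrite oppr_eq0 mulf_neq0 ?invr_eq0 //=.
  rewrite scaleNr -scalerA -scalerN eq_sym.
  move/eqP: E; rewrite addrC addr_eq0 => /eqP <-.
  by rewrite scalerA mulVf // scale1r.
split.
  apply/forallP => j; apply/eqP => Mj0.
  (* A zero column is a form on one coordinate; a second index, from [1 < n], makes it a form on
     two. *)
  have [i ij] := ord_neq_exists j n_gt1.
  have [|_ /eqP] := sep i j 0 1 ij; last by rewrite oner_eq0.
  by apply/comb0P; rewrite Mj0 scaler0 scale0r addr0.
apply/forallP => i; apply/forallP => j; apply/implyP => ij.
apply/existsP => -[a /andP[a_nz /eqP E]].
have [|_ /eqP] := sep i j (- a) 1 ij; last by rewrite oner_eq0.
by apply/comb0P; rewrite E scale1r scaleNr addNr.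
Qed.

Lemma projective_codeP k C : (1 < n)%N ->
  reflect (\dim C = k /\ separates_coordinates C) (C \in projective_code k).
Proof.
move=> n_gt1; rewrite inE; apply: (iffP andP) => [[/eqP <- /forallP pC] | [<- sC]].
  split=> //; have [M gM] := generator_matrix_exists C.
  by apply/(projective_columnsP n_gt1 gM); move: (pC M); rewrite gM.
split=> //; apply/forallP => M; apply/implyP => gM.
exact/(projective_columnsP n_gt1 gM).
Qed.

(** * Hyperplanes of a code and their projectivity *)

Lemma kernel_sub_scalar m (w u : 'cV[F]_m) : w != 0 ->
    (forall x : 'rV[F]_m, x *m w = 0 -> x *m u = 0) -> exists t, u = t *: w.
Proof.
move=> /eqP w_nz ker_sub.
have [i0 wi0] : exists i, w i 0 != 0.
  apply/existsP; apply: contra_notT w_nz => /existsPn w0.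
  by apply/colP => i; rewrite mxE; apply/eqP; have := w0 i; rewrite negbK.
exists (u i0 0 / w i0 0); apply/colP => i; rewrite mxE.
have rowE0 (v : 'cV[F]_m) l : (delta_mx 0 l : 'rV[F]_m) *m v = (v l 0)%:M.
  by rewrite -rowE [LHS]mx11_scalar mxE.
(* This combination of two unit vectors lies in the kernel of [w], so [u] vanishes on it. *)
have := ker_sub (delta_mx 0 i - (w i 0 / w i0 0) *: delta_mx 0 i0).
rewrite !mulmxBl -!scalemxAl !rowE0 !scale_scalar_mx divfK // subrr => /(_ erefl).
move/eqP; rewrite subr_eq0 => /eqP/matrixP/(_ 0 0).
by rewrite !mxE eqxx !mulr1n => ->; rewrite mulrAC [RHS]mulrAC [w i 0 * _]mulrC.
Qed.

Lemma subcode_memP m (M : 'M[F]_(m, n)) (w : 'cV[F]_m) (v : V) :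
  reflect (exists2 x : 'rV[F]_m, x *m w = 0 & v = x *m M) (v \in subcode M w).
Proof.
apply: (iffP memv_imgP) => -[x xw ->]; exists x; rewrite ?lfunE //.
  by move: xw; rewrite memv_ker lfunE => /eqP.
by rewrite memv_ker lfunE; apply/eqP.
Qed.

(** Encoding by [M] is injective, so the dimension is that of the kernel of a non-zero form. *)
Lemma dim_subcode m (M : 'M[F]_(m, n)) U (w : 'cV[F]_m) :
  generator_matrix M U -> w != 0 -> \dim (subcode M w) = m.-1.
Proof.
move=> gM w_nz; set f := linfun (mulmxr w : 'rV[F]_m -> 'M[F]_1).
rewrite /subcode limg_dim_eq; last by rewrite (lker_generator_matrix gM) capv0.
have := limg_ker_dim f fullv; rewrite capfv -/f !dimvf /dim /=.
have : (\dim (limg f) <= 1)%N.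
  by apply: leq_trans (dimvS (subvf _)) _; rewrite dimvf.
have : (0 < \dim (limg f))%N.
  rewrite lt0n dimv_eq0; apply: contra_neq w_nz => f0; apply/colP => i.
  have : f (delta_mx 0 i) \in limg f by rewrite memv_img // memvf.
  by rewrite f0 memv0 lfunE /= -rowE => /eqP/matrixP/(_ 0 0); rewrite !mxE.
lia.
Qed.

Lemma subcode_sub m (M : 'M[F]_(m, n)) U (w : 'cV[F]_m) :
  generator_matrix M U -> (subcode M w <= U)%VS.
Proof.
move=> gM; apply/subvP => v /subcode_memP[x _ ->].
by apply/(generator_matrix_memP _ gM); exists x.
Qed.

(** A generator matrix of [K] factors as [A *m M]. Since [A] has fewer rows than columns, some
    non-zero [w] satisfies [A *m w = 0]; a dimension count turns the inclusion into equality. *)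
Lemma hyperplane_subcode k (M : 'M[F]_(k.+1, n)) U K :
    generator_matrix M U -> \dim K = k -> (K <= U)%VS ->
  exists2 w, w != 0 & K = subcode M w.
Proof.
move=> gM dK sKU; have [B gB] := generator_matrix_exists K.
have /row_subP/submxP[A BE] : forall i, (row i B <= M)%MS.
  move=> i; have : row i B \in U.
    apply: (subvP sKU); apply/(generator_matrix_memP _ gB).
    by exists (delta_mx 0 i); rewrite -rowE.
  by move/(generator_matrix_memP _ gM) => [x ->]; apply: submxMl.
have : cokermx A != 0.
  rewrite -mxrank_eq0 mxrank_coker -lt0n subn_gt0.
  by rewrite ltnS (leq_trans (rank_leq_row A)) ?dK.
move=> cA; have [j wj] : exists j, col j (cokermx A) != 0.
  apply/existsP; apply: contraNT cA => /existsPn c0; apply/eqP/matrixP => i j.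
  by have /negPn/eqP/colP/(_ i) := c0 j; rewrite !mxE.
exists (col j (cokermx A)) => //; apply/eqP; rewrite eqEdim.
rewrite (dim_subcode gM wj) [X in (_ <= X)%N]dK leqnn andbT; apply/subvP => v.
move/(generator_matrix_memP _ gB) => [x ->].
apply/subcode_memP; exists (x *m A); last by rewrite BE mulmxA.
by rewrite colE mulmxA -[x *m A *m _]mulmxA mulmx_coker mulmx0 mul0mx.
Qed.

(** A form on coordinates [i], [j] kills the subcode iff the matching combination of columns is a
    multiple [t *: w]. If [t = 0], projectivity of [U] makes the form zero; otherwise [w] is a
    combination of at most two columns, which [Yset M] excludes. *)
Lemma subcode_projectiveP k (M : 'M[F]_(k.+1, n)) U (w : 'cV[F]_k.+1) :
    (1 < n)%N -> U \in projective_code k.+1 -> generator_matrix M U -> w != 0 ->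
  reflect (w \in Yset M) (subcode M w \in projective_code k).
Proof.
move=> n_gt1 /(projective_codeP _ _ n_gt1)[_ sepU] gM w_nz.
apply: (iffP (projective_codeP _ _ n_gt1)) => [[_ sepC] | Yw].
  have nprop j a : w <> a *: col j M.
    move=> wE; have [i ij] := ord_neq_exists j n_gt1.
    have [|_ a0] := sepC i j 0 a ij; last first.
      by move/eqP: w_nz; rewrite wE a0 scale0r.
    by move=> _ /subcode_memP[x xw ->]; rewrite col_combE scale0r add0r -wE xw mxE.
  rewrite !inE w_nz /=; apply/andP; split.
    apply/forallP => j; apply/existsP => -[a /andP[_ /eqP]]; exact: nprop.
  apply/'forall_'forall_forallP => i j a; apply/forallP => b.
  apply/implyP => a_nz; apply/implyP => _; apply/eqP => wE.
  (* [Yset] allows [i = j], while separation needs distinct coordinates; here [w] is a multiple of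
     one column. *)
  have [ij | ij] := eqVneq i j.
    by apply: (nprop j (a + b)); rewrite scalerDl wE ij.
  have [|/eqP] := sepC i j a b ij; last by rewrite (negbTE a_nz).
  by move=> _ /subcode_memP[x xw ->]; rewrite col_combE -wE xw mxE.
split; first exact: dim_subcode gM w_nz.
move: Yw; rewrite !inE w_nz /= => /andP[/forallP nprop /forallP ncomb].
move=> i j a b ij van; have [t tE] : exists t, a *: col i M + b *: col j M = t *: w.
  apply: kernel_sub_scalar => // x xw; rewrite [LHS]mx11_scalar -col_combE van ?raddf0 //.
  by apply/subcode_memP; exists x.
have [t0 | t_nz] := eqVneq t 0.
  apply: (sepU i j) => // c /(generator_matrix_memP _ gM)[x ->].
  by rewrite col_combE tE t0 scale0r mulmx0 mxE.
have wE : w = (t^-1 * a) *: col i M + (t^-1 * b) *: col j M.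
  by rewrite -!scalerA -scalerDr tE scalerA mulVf // scale1r.
have [a0 | a_nz] := eqVneq a 0; have [b0 | b_nz] := eqVneq b 0 => //.
- case/existsP: (nprop j); exists (t^-1 * b).
  by rewrite mulf_neq0 ?invr_eq0 //= {1}wE a0 mulr0 scale0r add0r.
- case/existsP: (nprop i); exists (t^-1 * a).
  by rewrite mulf_neq0 ?invr_eq0 //= {1}wE b0 mulr0 scale0r addr0.
have /forallP/(_ j)/forallP/(_ (t^-1 * a))/forallP/(_ (t^-1 * b)) := ncomb i.
by rewrite -wE eqxx !mulf_neq0 ?invr_eq0.
Qed.

Lemma projective_topP k (M : 'M[F]_(k.+1, n)) U K :
    (1 < n)%N -> U \in projective_code k.+1 -> generator_matrix M U ->
  reflect (exists2 y, y \in Yset M & K = subcode M y) (K \in projective_top k U).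
Proof.
move=> n_gt1 pU gM; apply: (iffP andP) => [[pK sKU] | [y Yy ->]].
  have [dK _] := projective_codeP _ _ n_gt1 pK.
  have [w w_nz KE] := hyperplane_subcode gM dK sKU.
  by exists w => //; apply/(subcode_projectiveP n_gt1 pU gM w_nz); rewrite -KE.
split; last exact: subcode_sub gM.
by apply/(subcode_projectiveP n_gt1 pU gM) => //; move: Yy; rewrite !inE -andbA => /andP[].
Qed.

(** * Coordinate swaps *)

Lemma dim_cap_lker K (f : 'Hom(V, 'M[F]_1)) : (\dim K <= (\dim (K :&: lker f)).+1)%N.
Proof.
rewrite -(limg_ker_dim f K) -[leqRHS]addn1 leq_add2l.
by apply: leq_trans (dimvS (subvf _)) _; rewrite dimvf.
Qed.

(** The differences span the hyperplane of vectors with coordinate sum zero. *)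
Lemma differences_dim K :
    (forall i j, delta_mx 0 i - delta_mx 0 j \in K) -> (n <= (\dim K).+1)%N.
Proof.
move=> diffs; have [n0 | n_gt0] := posnP n; first by rewrite [leqLHS]n0.
set f := linfun (mulmxr (const_mx 1) : V -> 'M[F]_1).
have := dim_cap_lker fullv f; rewrite capfv dimvf /dim /= mul1n => /leq_trans; apply.
rewrite ltnS dimvS //; apply/subvP => c.
rewrite memv_ker lfunE /= => /eqP/matrixP/(_ 0 0).
rewrite !mxE => sum0; pose i0 := Ordinal n_gt0.
have -> : c = \sum_i c 0 i *: (delta_mx 0 i - delta_mx 0 i0).
  under eq_bigr do rewrite scalerBr.
  rewrite sumrB -scaler_suml -row_sum_delta.
  rewrite [X in X *: _](_ : _ = 0) ?scale0r ?subr0 // -[RHS]sum0.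
  by apply: eq_bigr => i _; rewrite mxE mulr1.
by apply: memv_suml => i _; rewrite memvZ.
Qed.

Definition coordinate_swap (i j : 'I_n) : 'End(V) :=
  linfun (mulmxr (perm_mx (tperm i j))).

Lemma coordinate_swapE i j (c : V) l :
  coordinate_swap i j c 0 l = c 0 (tperm i j l).
Proof. by rewrite lfunE /= -[in LHS]tpermV -col_permE mxE. Qed.

(** A form on two coordinates of the image is the same form on the swapped coordinates of [K]. *)
Lemma coordinate_swap_projective k i j K : (1 < n)%N ->
  K \in projective_code k -> (coordinate_swap i j @: K)%VS \in projective_code k.
Proof.
move=> n_gt1 /(projective_codeP _ _ n_gt1)[dK sepK]; apply/projective_codeP => //.
split.
  rewrite limg_dim_eq // (_ : lker _ = 0%VS) ?capv0 //.
  apply/eqP/lker0P => c d cd; apply/rowP => l.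
  by rewrite -[l](tpermK i j) -!coordinate_swapE cd.
move=> a b x y ab van; apply: (sepK (tperm i j a) (tperm i j b)).
  by rewrite (inj_eq perm_inj).
by move=> c Kc; rewrite -!coordinate_swapE van // memv_img.
Qed.

(** For [i != j], projectivity gives a codeword with different entries at [i] and [j]; subtracting
    its swap leaves a non-zero multiple of the difference. *)
Lemma coordinate_swap_fixed k i j K : (1 < n)%N -> K \in projective_code k ->
  (coordinate_swap i j @: K)%VS = K -> delta_mx 0 i - delta_mx 0 j \in K.
Proof.
move=> n_gt1 /(projective_codeP _ _ n_gt1)[dK sepK] fixK.
have [-> | ij] := eqVneq i j; first by rewrite subrr mem0v.
have [c Kc cij] : exists2 c : V, c \in K & c 0 i != c 0 j.
  have [/existsP[c /andP[]] | /existsPn noc] :=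
    boolP [exists c : V, (c \in K) && (c 0 i != c 0 j)]; first by exists c.
  have [|/eqP] := sepK i j 1 (-1) ij; last by rewrite oner_eq0.
  move=> c Kc; have := noc c; rewrite Kc negbK => /eqP ->.
  by rewrite mulN1r mul1r subrr.
have : c - coordinate_swap i j c \in K by rewrite memvB // -fixK memv_img.
have -> : c - coordinate_swap i j c = (c 0 i - c 0 j) *: (delta_mx 0 i - delta_mx 0 j).
  apply/rowP => l; rewrite !mxE coordinate_swapE.
  case: tpermP => [-> | -> | /eqP li /eqP lj].
  - by rewrite !eqxx (negbTE ij) subr0 mulr1.
  - by rewrite !eqxx eq_sym (negbTE ij) sub0r mulrN1 opprB.
  - by rewrite (negbTE li) (negbTE lj) !subrr mulr0.
by rewrite rpredZeq subr_eq0 (negbTE cij).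
Qed.

(** Codewords with equal entries at [i] and [j] are fixed by the swap, and they have codimension at
    most one in [K]. *)
Lemma coordinate_swap_cap i j K :
  (\dim K <= (\dim (K :&: coordinate_swap i j @: K)).+1)%N.
Proof.
set f := linfun (mulmxr (delta_mx i 0 - delta_mx j 0) : V -> 'M[F]_1).
apply: leq_trans (dim_cap_lker K f) _; rewrite ltnS dimvS // subv_cap capvSl.
apply/subvP => c; rewrite memv_cap memv_ker lfunE /= mulmxBr -!colE subr_eq0.
move=> /andP[Kc /eqP/matrixP/(_ 0 0)]; rewrite !mxE => cij.
suff <- : coordinate_swap i j c = c by rewrite memv_img.
by apply/rowP => l; rewrite coordinate_swapE; case: tpermP => // ->.
Qed.

(** * Adjacency and intersections *)

Lemma dim_cap_lt k K L : \dim K = k -> \dim L = k -> K != L -> (\dim (K :&: L) < k)%N.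
Proof.
move=> dK dL; apply: contraNltn => le_k; apply/eqP.
have KI : (K :&: L)%VS = K by apply/eqP; rewrite eqEdim capvSl dK.
by apply/eqP; rewrite eqEdim -{1}KI capvSr dK dL leqnn.
Qed.

Lemma projective_code_adjacent k K : (1 < k < n - 1)%N -> K \in projective_code k ->
  exists L, adjacent k K L.
Proof.
move=> hk pK; have n_gt1 : (1 < n)%N by lia.
have [dK sepK] := projective_codeP _ _ n_gt1 pK.
have [/'exists_existsP[i [j ndiff]] | /existsPn diffs] :=
  boolP [exists i, exists j, delta_mx 0 i - delta_mx 0 j \notin K].
  exists (coordinate_swap i j @: K)%VS; rewrite /adjacent pK coordinate_swap_projective //=.
  have ne : K != (coordinate_swap i j @: K)%VS.
    by apply: contraNneq ndiff => /esym/(coordinate_swap_fixed n_gt1 pK).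
  rewrite ne /=; have := coordinate_swap_cap i j K.
  have [dL _] := projective_codeP _ _ n_gt1 (coordinate_swap_projective i j n_gt1 pK).
  have := dim_cap_lt dK dL ne; lia.
suff : (n <= (\dim K).+1)%N by lia.
apply: differences_dim => i j; have /existsPn/(_ j) := diffs i.
by rewrite negbK.
Qed.

Lemma projective_top_adjacent k U : (1 < k < n - 1)%N -> \dim U = k.+1 ->
  {in projective_top k U &, forall K L, K != L -> adjacent k K L}.
Proof.
move=> hk dU K L /andP[pK sKU] /andP[pL sLU] ne; have n_gt1 : (1 < n)%N by lia.
have [dK _] := projective_codeP _ _ n_gt1 pK.
have [dL _] := projective_codeP _ _ n_gt1 pL.
rewrite /adjacent pK pL ne /=; have := dim_cap_lt dK dL ne.
have : (\dim (K + L) <= k.+1)%N by rewrite -dU dimvS // subv_add sKU.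
have := dimv_sum_cap K L; rewrite dK dL; lia.
Qed.

Lemma projective_star_adjacent k S : (1 < k < n - 1)%N -> \dim S = k.-1 ->
  {in projective_star k S &, forall K L, K != L -> adjacent k K L}.
Proof.
move=> hk dS K L /andP[pK sSK] /andP[pL sSL] ne; have n_gt1 : (1 < n)%N by lia.
have [dK _] := projective_codeP _ _ n_gt1 pK.
have [dL _] := projective_codeP _ _ n_gt1 pL.
rewrite /adjacent pK pL ne /=; have := dim_cap_lt dK dL ne.
have : (k.-1 <= \dim (K :&: L))%N by rewrite -dS dimvS // subv_cap sSK.
lia.
Qed.

(** [K :&: L] lies in [K :&: U], a proper subspace of [K], whose dimension is thus at most
    [k - 1]. *)
Lemma cap_outside k U K L : (0 < k)%N -> \dim K = k -> ~~ (K <= U)%VS ->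
  (L <= U)%VS -> \dim (K :&: L) = k.-1 -> (K :&: U = K :&: L)%VS.
Proof.
move=> k_gt0 dK nKU sLU dKL; apply/esym/eqP.
rewrite eqEdim capvS // dKL -ltnS prednK //.
have KU : (K :&: U)%VS != K by apply: contraNneq nKU => <-; rewrite capvSr.
rewrite ltnNge -dK; apply: contra KU => le_K.
by rewrite eqEdim capvSl.
Qed.

Lemma subspace_of_dim U m : (m <= \dim U)%N -> exists2 S, (S <= U)%VS & \dim S = m.
Proof.
move=> le_m; have fU := basis_free (vbasisP U).
have fS : free (take m (vbasis U)).
  by move: fU; rewrite -{1}(cat_take_drop m (vbasis U)) => /catl_free.
exists <<take m (vbasis U)>>%VS.
  apply/span_subvP => v /mem_take; exact: vbasis_mem.
by move/eqP: fS => ->; rewrite size_takel ?size_tuple.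
Qed.

End ProjectiveCodes.

(** * Maximality of the top of [U] *)

Theorem theorem2 (F : finFieldType) (n k : nat) (hk : (1 < k < n - 1)%N)
    (U : {vspace 'rV[F]_n}) (hU : U \in projective_code k.+1)
    (M : 'M[F]_(k.+1, n)) (hM : generator_matrix M U) :
  maximal_clique k (projective_top k U) <->
  (~ (exists L : {pred {vspace 'rV[F]_n}},
        is_line k L /\ {subset projective_top k U <= L}) \/
   let S := (\bigcap_(y in Yset M) subcode M y)%VS in
   \dim S = k.-1 /\ projective_top k U =i projective_star k S).
Proof.
have n_gt1 : (1 < n)%N by lia.
have [dU _] := projective_codeP _ _ n_gt1 hU.
have topP K := projective_topP K n_gt1 hU hM.
have dim_top K : K \in projective_top k U -> \dim K = k.
  by case/andP=> /(projective_codeP _ _ n_gt1)[].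
set S := (\bigcap_(y in Yset M) subcode M y)%VS.
have S_sub K : K \in projective_top k U -> (S <= K)%VS.
  by case/topP=> y Yy ->; apply: (bigcapv_inf y).
have sub_S T : (forall K, K \in projective_top k U -> (T <= K)%VS) -> (T <= S)%VS.
  by move=> subT; apply/subv_bigcapP => y Yy; apply/subT/topP; exists y.
(* Emptiness is decided constructively through the finite set [Yset M]. *)
have top_dec : (exists K, K \in projective_top k U) \/
    (forall K, K \in projective_top k U -> False).
  have [Y0 | [y Yy]] := set_0Vmem (Yset M); last first.
    by left; exists (subcode M y); apply/topP; exists y.
  by right=> K /topP[y]; rewrite Y0 inE.
have segment_line T : (T <= U)%VS -> \dim T = k.-1 -> is_line k (segment k T U).
  by move=> sTU dT; exists T, U.
(* Gives a line chosen without using members of the top; an empty top lies in it. *)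
have [T0 sT0U dT0] : exists2 T, (T <= U)%VS & \dim T = k.-1.
  by apply: subspace_of_dim; rewrite dU; lia.
(* Shared by both converse cases: a code outside [U] that extends the clique meets [U] in a
   [(k - 1)]-dimensional subspace of every member. *)
have top_maximal : (exists K, K \in projective_top k U) ->
    (forall K, K \in projective_code k -> ~~ (K <= U)%VS ->
       (forall L, L \in projective_top k U -> (K :&: U <= L)%VS) ->
       \dim (K :&: U) = k.-1 -> False) ->
    maximal_clique k (projective_top k U).
  move=> [K0 K0top] no_ext; split.
    split; first by exists K0.
      by move=> K /andP[].
    exact: projective_top_adjacent.
  move=> B [_ Bproj Badj] topB K; apply/idP/idP => [BK | /topB //].
  have pK := Bproj _ BK; have [dK _] := projective_codeP _ _ n_gt1 pK.
  apply/andP; split=> //; apply/negPn/negP => nKU.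
  have capE L : L \in projective_top k U -> (K :&: U = K :&: L)%VS /\ \dim (K :&: U) = k.-1.
    move=> Ltop; have /andP[_ sLU] := Ltop.
    have /Badj-/(_ L (topB _ Ltop)) := BK.
    have ne : K != L by apply: contraNneq nKU => ->.
    move=> /(_ ne) /and4P[_ _ _ /eqP dKL].
    by rewrite (cap_outside _ dK nKU sLU dKL) //; lia.
  apply: (no_ext K pK nKU); last by case: (capE K0 K0top).
  by move=> L /capE[-> _]; apply: capvSr.
split=> [[[[K0 K0top] _ _] top_max] | [nline | [dS topS]]]; last 2 first.
- apply: top_maximal.
    have [// | top0] := top_dec.
    case: nline; exists (segment k T0 U); split; first exact: segment_line.
    by move=> K /top0.
  move=> K pK nKU sub dKU; apply: nline; exists (segment k (K :&: U) U).
  split; first by apply: segment_line => //; apply: capvSr.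
  move=> L Ltop; have /andP[_ sLU] := Ltop.
  by rewrite inE dim_top // eqxx sub.
- apply: top_maximal.
    have [// | top0] := top_dec.
    (* Over an empty top [S] would be the whole space, of dimension [n], not [k - 1]. *)
    have : (fullv <= S)%VS by apply: sub_S => K /top0.
    by move/dimvS; rewrite dS dimvf /dim /=; lia.
  move=> K pK nKU sub dKU; have KUS : (K :&: U <= S)%VS by apply: sub_S.
  (* Hence [K] contains [S] and belongs to the star, that is, to the top, although it is not inside
     [U]. *)
  have SE : S = (K :&: U)%VS by apply/esym/eqP; rewrite eqEdim KUS dS dKU /=.
  have : K \in projective_top k U by rewrite topS inE pK SE capvSl.
  by rewrite inE (negbTE nKU) andbF.
(* If [K0] were the only member, it would form a larger clique with any neighbour; maximality puts
   that neighbour into the top. *)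
have [K1 K1top K01] : exists2 K, K \in projective_top k U & K0 != K.
  have [/exists_inP[y Yy neK] | /exists_inPn top1] :=
    boolP [exists y in Yset M, K0 != subcode M y].
    by exists (subcode M y) => //; apply/topP; exists y.
  have /andP[pK0 _] := K0top.
  have [K adjK] := projective_code_adjacent hk pK0.
  have pK : K \in projective_code k by case/and4P: adjK.
  have neK : K0 != K by case/and4P: adjK.
  have adjKs : adjacent k K K0.
    by case/and4P: adjK => *; rewrite /adjacent pK pK0 eq_sym neK capvC.
  exists K => //; rewrite -(top_max [pred L | (L == K0) || (L == K)]).
  - by rewrite inE eqxx orbT.
  - split; first by exists K; rewrite inE eqxx orbT.
      by move=> L /orP[]/eqP->.
    move=> L L' /orP[]/eqP-> /orP[]/eqP-> //; rewrite ?eqxx //.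
  - by move=> L /topP[y /top1 /negPn/eqP <- ->]; rewrite inE eqxx.
have dK01 : \dim (K0 :&: K1) = k.-1.
  by have /and4P[_ _ _ /eqP] := projective_top_adjacent hk dU K0top K1top K01.
have sS01 : (S <= K0 :&: K1)%VS by rewrite subv_cap !S_sub.
(* Two members bound [\dim S] by [k - 1], and the base of a line containing the top would lie in
   [S], so a smaller [S] excludes every line. *)
have [dS | ndS] := eqVneq (\dim S) k.-1; last first.
  left=> -[L [[T [U' [dT _ _ LE]]] topL]]; case/eqP: ndS.
  apply/eqP; rewrite eqn_leq -{1}dK01 -dT !dimvS //; apply: sub_S => K /topL.
  by rewrite LE => /and3P[].
(* The star of [S] is a clique containing the top, so maximality makes them equal. *)
right; split=> // K; apply/esym; apply: (top_max (projective_star k S)).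
  split; first by exists K0; rewrite inE S_sub // andbT; case/andP: K0top.
    by move=> L /andP[].
  exact: projective_star_adjacent.
by move=> L Ltop; rewrite inE S_sub // andbT; case/andP: Ltop.
Qed.
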